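(* For every integer $n\geq 0$ the following two identities hold in $\Delta_q$, where $B_{n\delta+\alpha_0}$ and $B_{n\delta+\alpha_1}$ denote the images in $\Delta_q$, under the algebra homomorphism $\natural:\mathcal O_q\to\Delta_q$, of the elements of $\mathcal O_q$ with the same names: \begin{align*} B_{n\delta+\alpha_0} &= (-1)^n q^{-n} A\, U_n(C)+(-1)^n q^{-n-1} B\, U_{n-1}(C)+(-1)^n \alpha \sum_{j \in \mathbb N} q^{2j-n+1} U_{n-2j-2}(C)\\ &\quad + (-1)^{n-1} \beta \sum_{j\in \mathbb N} q^{2j-n} U_{n-2j-1}(C),\\ B_{n\delta+\alpha_1} &= (-1)^n q^{n} B\, U_n(C)+ (-1)^n q^{n+1} A\, U_{n-1}(C)+(-1)^n \beta \sum_{j \in \mathbb N}q^{n-2j-1} U_{n-2j-2}(C)\\ &\quad + (-1)^{n-1}\alpha\sum_{j\in \mathbb N} q^{n-2j} U_{n-2j-1}(C). \end{align*}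
   Context: $\mathbb N=\{0,1,2,\ldots\}$. $\mathbb F$ is an algebraically closed field of characteristic zero; $q\in\mathbb F$ is nonzero and not a root of $1$. Algebras are associative unital $\mathbb F$-algebras. For $n\in\mathbb Z$, $[n]_q=\frac{q^n-q^{-n}}{q-q^{-1}}$. The $q$-Onsager algebra $\mathcal O_q$ is the algebra with generators $A,B$ and relations $A^3B-[3]_qA^2BA+[3]_qABA^2-BA^3=(q^2-q^{-2})^2(BA-AB)$ and $B^3A-[3]_qB^2AB+[3]_qBAB^2-AB^3=(q^2-q^{-2})^2(AB-BA)$. It is known (Baseilhac and Kolb) that $\mathcal O_q$ has algebra automorphisms $T_0,T_1$ determined by $T_0(A)=A$, $T_0(B)=B+\frac{qA^2B-(q+q^{-1})ABA+q^{-1}BA^2}{(q-q^{-1})(q^2-q^{-2})}$, $T_1(B)=B$, $T_1(A)=A+\frac{qB^2A-(q+q^{-1})BAB+q^{-1}AB^2}{(q-q^{-1})(q^2-q^{-2})}$, whose inverses satisfy $T_0^{-1}(A)=A$, $T_0^{-1}(B)=B+\frac{q^{-1}A^2B-(q+q^{-1})ABA+qBA^2}{(q-q^{-1})(q^2-q^{-2})}$, $T_1^{-1}(B)=B$, $T_1^{-1}(A)=A+\frac{q^{-1}B^2A-(q+q^{-1})BAB+qAB^2}{(q-q^{-1})(q^2-q^{-2})}$. Elements of $\mathcal O_q$: for $r\geq 0$, $B_{2r\delta+\alpha_0}=(T_0T_1)^r(A)$, $B_{(2r+1)\delta+\alpha_0}=(T_0T_1)^rT_0(B)$, $B_{2r\delta+\alpha_1}=(T_1^{-1}T_0^{-1})^r(B)$,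 $B_{(2r+1)\delta+\alpha_1}=(T_1^{-1}T_0^{-1})^rT_1^{-1}(A)$. The universal Askey--Wilson algebra $\Delta_q$ is the algebra with generators $A,B,C$ and relations asserting that each of $A+\frac{qBC-q^{-1}CB}{q^2-q^{-2}}$, $B+\frac{qCA-q^{-1}AC}{q^2-q^{-2}}$, $C+\frac{qAB-q^{-1}BA}{q^2-q^{-2}}$ is central. The central elements $\alpha,\beta,\gamma$ of $\Delta_q$ are these three elements, respectively, each multiplied by $q+q^{-1}$. It is known that there is an algebra homomorphism $\natural:\mathcal O_q\to\Delta_q$ sending $A\mapsto A$, $B\mapsto B$. For the elements $B_{n\delta+\alpha_0}$ and $B_{n\delta+\alpha_1}$ ($n\geq 0$) of $\mathcal O_q$, the same notation is used for their images under $\natural$. Chebyshev polynomials of the second kind (monic normalization): $U_n\in\mathbb F[x]$ with $U_0=1$, $U_1=x$, $xU_n=U_{n+1}+U_{n-1}$ for $n\geq1$, and $U_n=0$ for all integers $n<0$ (so all the sums over $\mathbb N$ are finite). *)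

(* Defs.v *)
From HB Require Import structures.
From mathcomp Require Import all_boot all_algebra generic_quotient ring_quotient.
From mathcomp Require Import boolp.
From mathcomp.multinomials Require Import monalg.
From mathcomp Require Import finmap.

Set Implicit Arguments.
Unset Strict Implicit.
Unset Printing Implicit Defensive.

Import GRing.Theory Quotient.

Local Open Scope ring_scope.
Local Open Scope quotient_scope.

(* The monoid algebra of the free monoid on I, i.e. noncommutative polynomials;
   the library equips it with a left-algebra structure only. *)
Definition freealg (F : fieldType) (I : choiceType) : Type :=
  {malg F[{fmonom I}]}.

Section FreeAlgebra.
Variables (F : fieldType) (I : choiceType).

HB.instance Definition _ := GRing.Lalgebra.on (freealg F I).

Lemma freealg_scaleAr (c : F) (x y : freealg F I) : c *: (x * y) = x * (c *: y).
Proof.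
apply/malgP => k; rewrite mcoeffZ mcoeffMl.
rewrite (mcoeffMlw _ (fsubset_refl _) (msuppZ_le c y)).
rewrite mulr_sumr; apply: eq_bigr => k1 _.
rewrite mulr_sumr; apply: eq_bigr => k2 _.
by rewrite mcoeffZ mulrCA mulrnAr.
Qed.

HB.instance Definition _ :=
  GRing.Lalgebra_isAlgebra.Build F (freealg F I) freealg_scaleAr.

Definition fgen (i : I) : freealg F I := << 1 *g fmu i >>.

(* The constant coefficient, i.e. evaluation with all generators set to 0. *)
Definition augment (x : freealg F I) : F :=
  mcoeff (mone : {fmonom I}) (x : {malg F[{fmonom I}]}).

Lemma augment_is_zmod_morphism : zmod_morphism augment.
Proof. exact: raddfB. Qed.

HB.instance Definition _ :=
  GRing.isZmodMorphism.Build (freealg F I) F augment augment_is_zmod_morphism.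

Lemma augment_is_monoid_morphism : monoid_morphism augment.
Proof.
split; first exact: (rmorph1 (mcoeff (mone : {fmonom I}))).
exact: (rmorphM (mcoeff (mone : {fmonom I}))).
Qed.

HB.instance Definition _ :=
  GRing.isMonoidMorphism.Build (freealg F I) F augment
    augment_is_monoid_morphism.

Lemma augment_is_scalable : scalable_for *%R augment.
Proof. by move=> c x; apply: mcoeffZ. Qed.

HB.instance Definition _ :=
  GRing.isScalable.Build F (freealg F I) F *%R augment augment_is_scalable.

Lemma augmentB : {morph augment : x y / x - y}. Proof. exact: rmorphB. Qed.
Lemma augmentD : {morph augment : x y / x + y}. Proof. exact: rmorphD. Qed.
Lemma augmentM : {morph augment : x y / x * y}. Proof. exact: rmorphM. Qed.
Lemma augmentZ c : {morph augment : x / c *: x >-> c * x}.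
Proof. exact: augment_is_scalable. Qed.

Lemma augment_gen i : augment (fgen i) = 0.
Proof.
by rewrite /augment /fgen mcoeffU -fdeg_eq0 fdegU.
Qed.

End FreeAlgebra.

Section Presentation.
Variables (F : fieldType) (I : choiceType) (S : freealg F I -> Prop).

(* Membership in the two-sided ideal generated by S. *)
Inductive in_ideal : freealg F I -> Prop :=
| in_ideal0 : in_ideal 0
| in_ideal_step u r v x : S r -> in_ideal x -> in_ideal (u * r * v + x).

Definition ideal : {pred freealg F I} := fun x => `[< in_ideal x >].

Lemma idealP x : reflect (in_ideal x) (x \in ideal).
Proof. exact: asboolP. Qed.

Lemma in_idealD x y : in_ideal x -> in_ideal y -> in_ideal (x + y).
Proof.
move=> + Iy; elim=> [|u r v {}x Sr _ IH]; first by rewrite add0r.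
by rewrite -addrA; apply: in_ideal_step.
Qed.

Lemma in_idealN x : in_ideal x -> in_ideal (- x).
Proof.
elim=> [|u r v {}x Sr _ IH]; first by rewrite oppr0; apply: in_ideal0.
by rewrite opprD -!mulNr; apply: in_ideal_step.
Qed.

Lemma in_idealMl a x : in_ideal x -> in_ideal (a * x).
Proof.
elim=> [|u r v {}x Sr _ IH]; first by rewrite mulr0; apply: in_ideal0.
by rewrite mulrDr !mulrA; apply: in_ideal_step.
Qed.

Lemma in_idealMr a x : in_ideal x -> in_ideal (x * a).
Proof.
elim=> [|u r v {}x Sr _ IH]; first by rewrite mul0r; apply: in_ideal0.
by rewrite mulrDl -!mulrA mulrA; apply: in_ideal_step.
Qed.

Lemma ideal_zmod_closed : zmod_closed ideal.
Proof.
split; first by apply/idealP; apply: in_ideal0.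
move=> x y /idealP Ix /idealP Iy; apply/idealP.
exact: in_idealD (in_idealN Iy).
Qed.

HB.instance Definition _ :=
  GRing.isZmodClosed.Build (freealg F I) ideal ideal_zmod_closed.

(* The library's algebras are nontrivial rings, so the quotient is formed under
   the assumption that the relators have no constant term. *)
Hypothesis augS : forall r, S r -> augment r = 0.

Lemma augment_ideal x : in_ideal x -> augment x = 0.
Proof.
elim=> [|u r v {}x Sr _ IH]; first exact: rmorph0.
by rewrite rmorphD !rmorphM /= (augS Sr) mulr0 mul0r IH addr0.
Qed.

Definition presalg of (forall r, S r -> augment r = 0) : Type :=
  {quot ideal}.

Local Notation Q := (presalg augS).

HB.instance Definition _ := GRing.Zmodule.on Q.
HB.instance Definition _ := EqQuotient.on Q.
HB.instance Definition _ := ZmodQuotient.on Q.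

Definition pres_pi (x : freealg F I) : Q := \pi_{quot ideal} x.

Lemma pres_piP x y : reflect (pres_pi x = pres_pi y) (x - y \in ideal).
Proof. by rewrite (idealrBE ideal); apply: eqP. Qed.

Lemma pres_reprK (x : Q) : pres_pi (repr (x : {quot ideal})) = x.
Proof. exact: reprK. Qed.

Lemma pres_pi_is_zmod_morphism : zmod_morphism pres_pi.
Proof. exact: (raddfB \pi_{quot ideal}). Qed.

HB.instance Definition _ :=
  GRing.isZmodMorphism.Build (freealg F I) Q pres_pi pres_pi_is_zmod_morphism.

Definition pres_one : Q := pres_pi 1.
Definition pres_mul (x y : Q) : Q :=
  pres_pi (repr (x : {quot ideal}) * repr (y : {quot ideal})).
Definition pres_scale (c : F) (x : Q) : Q :=
  pres_pi (c *: repr (x : {quot ideal})).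

Lemma repr_pi x : repr (pres_pi x : {quot ideal}) - x \in ideal.
Proof. by apply/pres_piP; rewrite pres_reprK. Qed.

Lemma pres_piM x y : pres_mul (pres_pi x) (pres_pi y) = pres_pi (x * y).
Proof.
apply/pres_piP; rewrite -[_ * _](addrNK (x * repr (pres_pi y : {quot ideal}))).
rewrite -mulrBl -addrA -mulrBr rpredD //; apply/idealP.
  by apply: in_idealMr; apply/idealP/repr_pi.
by apply: in_idealMl; apply/idealP/repr_pi.
Qed.

Lemma pres_piZ c x : pres_scale c (pres_pi x) = pres_pi (c *: x).
Proof.
apply/pres_piP; rewrite -scalerBr -[_ - _]mul1r scalerAl.
by apply/idealP/in_idealMl/idealP/repr_pi.
Qed.

Lemma pres_mulA : associative pres_mul.
Proof.
by move=> x y z; rewrite -[x]pres_reprK -[y]pres_reprK -[z]pres_reprK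
  !pres_piM mulrA.
Qed.

Lemma pres_mul1 : left_id pres_one pres_mul.
Proof. by move=> x; rewrite -[x]pres_reprK pres_piM mul1r. Qed.

Lemma pres_1mul : right_id pres_one pres_mul.
Proof. by move=> x; rewrite -[x]pres_reprK pres_piM mulr1. Qed.

Lemma pres_mulDl : left_distributive pres_mul +%R.
Proof.
move=> x y z; rewrite -[x]pres_reprK -[y]pres_reprK -[z]pres_reprK.
by rewrite -raddfD !pres_piM mulrDl raddfD.
Qed.

Lemma pres_mulDr : right_distributive pres_mul +%R.
Proof.
move=> x y z; rewrite -[x]pres_reprK -[y]pres_reprK -[z]pres_reprK.
by rewrite -raddfD !pres_piM mulrDr raddfD.
Qed.

Lemma pres_one_neq0 : pres_one != 0.
Proof.
apply/eqP; rewrite -[0](raddf0 pres_pi) => /pres_piP/idealP/augment_ideal/eqP.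
by rewrite subr0 rmorph1 oner_eq0.
Qed.

HB.instance Definition _ := GRing.Zmodule_isNzRing.Build Q
  pres_mulA pres_mul1 pres_1mul pres_mulDl pres_mulDr pres_one_neq0.

Lemma pres_scaleA c d x : pres_scale c (pres_scale d x) = pres_scale (c * d) x.
Proof. by rewrite -[x]pres_reprK !pres_piZ scalerA. Qed.

Lemma pres_scale1 : left_id 1 pres_scale.
Proof. by move=> x; rewrite -[x]pres_reprK pres_piZ scale1r. Qed.

Lemma pres_scaleDr : right_distributive pres_scale +%R.
Proof.
move=> c x y; rewrite -[x]pres_reprK -[y]pres_reprK.
by rewrite -raddfD !pres_piZ scalerDr raddfD.
Qed.

Lemma pres_scaleDl x : {morph pres_scale^~ x : c d / c + d}.
Proof. by move=> c d; rewrite -[x]pres_reprK !pres_piZ scalerDl raddfD. Qed.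

HB.instance Definition _ := GRing.Zmodule_isLmodule.Build F Q
  pres_scaleA pres_scale1 pres_scaleDr pres_scaleDl.

Lemma pres_scaleAl (c : F) (x y : Q) : c *: (x * y) = (c *: x) * y.
Proof.
rewrite -[x]pres_reprK -[y]pres_reprK /GRing.mul /GRing.scale /=.
by rewrite !(pres_piM, pres_piZ) scalerAl.
Qed.

HB.instance Definition _ := GRing.Lmodule_isLalgebra.Build F Q pres_scaleAl.

Lemma pres_scaleAr (c : F) (x y : Q) : c *: (x * y) = x * (c *: y).
Proof.
rewrite -[x]pres_reprK -[y]pres_reprK /GRing.mul /GRing.scale /=.
by rewrite !(pres_piM, pres_piZ) scalerAr.
Qed.

HB.instance Definition _ := GRing.Lalgebra_isAlgebra.Build F Q pres_scaleAr.

Lemma pres_pi_is_monoid_morphism : monoid_morphism pres_pi.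
Proof. by split=> [|x y]; [exact: erefl | exact: esym (pres_piM x y)]. Qed.

HB.instance Definition _ :=
  GRing.isMonoidMorphism.Build (freealg F I) Q pres_pi
    pres_pi_is_monoid_morphism.

Lemma pres_pi_is_scalable : scalable pres_pi.
Proof. by move=> c x; exact: esym (pres_piZ c x). Qed.

HB.instance Definition _ :=
  GRing.isScalable.Build F (freealg F I) Q *:%R pres_pi pres_pi_is_scalable.

Definition pgen (i : I) : Q := pres_pi (fgen F i).

Lemma pres_pi_eq0 x : in_ideal x <-> pres_pi x = 0.
Proof.
rewrite -(raddf0 pres_pi); split; last by move/pres_piP/idealP; rewrite subr0.
by move=> Ix; apply/pres_piP/idealP; rewrite subr0.
Qed.

Lemma pres_rel r : S r -> pres_pi r = 0.
Proof.
move=> Sr; apply/pres_pi_eq0; rewrite -[r]mul1r -[1 * r]mulr1 -[_ * 1]addr0.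
exact: in_ideal_step Sr in_ideal0.
Qed.

End Presentation.

Definition qnum (F : fieldType) (q : F) (n : int) : F :=
  (q ^ n - q ^ (- n)) / (q - q^-1).

Section Expressions.
Variables (F : fieldType) (q : F) (R : algType F).
Implicit Types x y z : R.

(* The q-Onsager relations are qDG_lhs A B = qDG_rhs A B and
   qDG_lhs B A = qDG_rhs B A. *)
Definition qDG_lhs x y : R :=
  x ^+ 3 * y - qnum q 3 *: (x ^+ 2 * y * x)
    + qnum q 3 *: (x * y * x ^+ 2) - y * x ^+ 3.

Definition qDG_rhs x y : R := (q ^+ 2 - q ^- 2) ^+ 2 *: (y * x - x * y).

(* T_0 sends B to braid A B, and T_1 sends A to braid B A. *)
Definition braid x y : R :=
  y + ((q - q^-1) * (q ^+ 2 - q ^- 2))^-1 *: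
      (q *: (x ^+ 2 * y) - (q + q^-1) *: (x * y * x) + q^-1 *: (y * x ^+ 2)).

(* The element x + (q y z - q^-1 z y) / (q^2 - q^-2), to be taken at the three
   cyclic shifts of (A, B, C). *)
Definition AWelt x y z : R :=
  x + (q ^+ 2 - q ^- 2)^-1 *: (q *: (y * z) - q^-1 *: (z * y)).

Lemma qDG_ker (f : R -> F) x y :
    {morph f : u v / u - v} -> {morph f : u v / u + v} ->
    {morph f : u v / u * v} -> (forall c, {morph f : u / c *: u >-> c * u}) ->
  f x = 0 -> f y = 0 -> f (qDG_lhs x y - qDG_rhs x y) = 0.
Proof.
move=> fB fD fM fZ fx fy; rewrite /qDG_lhs /qDG_rhs !exprS expr0 !mulr1.
by rewrite !(fB, fD, fZ, fM) fx fy !(mulr0, mul0r, subr0, addr0).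
Qed.

End Expressions.

Section ExpressionsMorphism.
Variables (F : fieldType) (q : F) (R R' : algType F) (f : {lrmorphism R -> R'}).

Lemma qDG_morph x y :
  f (qDG_lhs q x y - qDG_rhs q x y)
  = qDG_lhs q (f x) (f y) - qDG_rhs q (f x) (f y).
Proof.
have fB u v : f (u - v) = f u - f v by exact: rmorphB.
have fD u v : f (u + v) = f u + f v by exact: rmorphD.
have fM u v : f (u * v) = f u * f v by exact: rmorphM.
have fZ (c : F) u : f (c *: u) = c *: f u by exact: linearZZ.
rewrite /qDG_lhs /qDG_rhs !exprS expr0 !mulr1.
by rewrite !(fB, fD, fZ, fM).
Qed.

Lemma AWelt_morph x y z : f (AWelt q x y z) = AWelt q (f x) (f y) (f z).
Proof.
have fZ (c : F) u : f (c *: u) = c *: f u by exact: linearZZ.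
have fB u v : f (u - v) = f u - f v by exact: rmorphB.
have fM u v : f (u * v) = f u * f v by exact: rmorphM.
by rewrite /AWelt rmorphD /= fZ fB !fZ !fM.
Qed.

End ExpressionsMorphism.

Section Onsager.
Variables (F : fieldType) (q : F).

Let a : freealg F 'I_2 := fgen F 0.
Let b : freealg F 'I_2 := fgen F 1.

Inductive Oq_rel : freealg F 'I_2 -> Prop :=
| Oq_relAB : Oq_rel (qDG_lhs q a b - qDG_rhs q a b)
| Oq_relBA : Oq_rel (qDG_lhs q b a - qDG_rhs q b a).

Lemma Oq_rel_augment r : Oq_rel r -> augment r = 0.
Proof.
have ker x y := @qDG_ker F q (freealg F 'I_2) (@augment F 'I_2) x y
  (@augmentB _ _) (@augmentD _ _) (@augmentM _ _) (@augmentZ _ _).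
by case; apply: ker; apply: augment_gen.
Qed.

Definition Oq : algType F := presalg Oq_rel_augment.
Definition OA : Oq := pgen Oq_rel_augment 0.
Definition OB : Oq := pgen Oq_rel_augment 1.

Lemma Oq_AB : qDG_lhs q OA OB = qDG_rhs q OA OB.
Proof.
apply/subr0_eq; rewrite -[RHS](pres_rel Oq_rel_augment Oq_relAB).
exact: esym (qDG_morph q (pres_pi Oq_rel_augment) a b).
Qed.

Lemma Oq_BA : qDG_lhs q OB OA = qDG_rhs q OB OA.
Proof.
apply/subr0_eq; rewrite -[RHS](pres_rel Oq_rel_augment Oq_relBA).
exact: esym (qDG_morph q (pres_pi Oq_rel_augment) b a).
Qed.

(* Balpha0 T0 T1 n is B_{n delta + alpha_0} and Balpha1 T0^-1 T1^-1 n is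
   B_{n delta + alpha_1}, where n = 2r or n = 2r + 1 with r = n./2. *)
Definition Balpha0 (T0 T1 : Oq -> Oq) (n : nat) : Oq :=
  iter n./2 (T0 \o T1) (if odd n then T0 OB else OA).

Definition Balpha1 (T0i T1i : Oq -> Oq) (n : nat) : Oq :=
  iter n./2 (T1i \o T0i) (if odd n then T1i OA else OB).

End Onsager.

Section AskeyWilson.
Variables (F : fieldType) (q : F).

Let a : freealg F 'I_3 := fgen F 0.
Let b : freealg F 'I_3 := fgen F 1.
Let c : freealg F 'I_3 := fgen F 2.

(* Centrality: the commutators with all elements x of the free algebra, not only
   with its generators. *)
Inductive Delta_rel : freealg F 'I_3 -> Prop :=
| Delta_relA x : Delta_rel (AWelt q a b c * x - x * AWelt q a b c)
| Delta_relB x : Delta_rel (AWelt q b c a * x - x * AWelt q b c a)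
| Delta_relC x : Delta_rel (AWelt q c a b * x - x * AWelt q c a b).

Lemma Delta_rel_augment r : Delta_rel r -> augment r = 0.
Proof. by case=> x; rewrite augmentB !augmentM mulrC subrr. Qed.

Definition Delta : algType F := presalg Delta_rel_augment.
Definition DA : Delta := pgen Delta_rel_augment 0.
Definition DB : Delta := pgen Delta_rel_augment 1.
Definition DC : Delta := pgen Delta_rel_augment 2.

Lemma Delta_central :
  forall X : Delta, [/\ GRing.comm (AWelt q DA DB DC) X,
    GRing.comm (AWelt q DB DC DA) X & GRing.comm (AWelt q DC DA DB) X].
Proof.
move=> X; rewrite -[X](pres_reprK (augS := Delta_rel_augment)).
move: (repr _) => x; pose f := pres_pi Delta_rel_augment.
have fB u v : f (u - v) = f u - f v by exact: rmorphB.
have fM u v : f (u * v) = f u * f v by exact: rmorphM.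
have comm u : Delta_rel (u * x - x * u) -> GRing.comm (f u) (f x).
  by move=> /(pres_rel Delta_rel_augment) fu; apply/subr0_eq; rewrite -!fM -fB.
have fW u v w : AWelt q (f u) (f v) (f w) = f (AWelt q u v w).
  exact: esym (AWelt_morph q (pres_pi Delta_rel_augment) u v w).
split.
- by have := comm _ (Delta_relA x); rewrite -fW.
- by have := comm _ (Delta_relB x); rewrite -fW.
- by have := comm _ (Delta_relC x); rewrite -fW.
Qed.

Definition Dalpha : Delta := (q + q^-1) *: AWelt q DA DB DC.
Definition Dbeta : Delta := (q + q^-1) *: AWelt q DB DC DA.

End AskeyWilson.

Section Chebyshev.
Variable F : fieldType.

Fixpoint chebU_nat (n : nat) : {poly F} :=
  match n with
  | 0 => 1
  | m.+1 => match m with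
            | 0 => 'X
            | k.+1 => 'X * chebU_nat m - chebU_nat k
            end
  end.

Definition chebU (n : int) : {poly F} :=
  match n with Posz m => chebU_nat m | Negz _ => 0 end.

End Chebyshev.

Definition UC (F : fieldType) (q : F) (n : int) : Delta q :=
  horner_alg (DC q) (chebU F n).

(* Hence a sum over all natural j of terms in U_{n-2j-1} or U_{n-2j-2} only
   involves indices j <= n. *)
Lemma UC_lt0 (F : fieldType) (q : F) (n : int) : n < 0 -> UC q n = 0.
Proof. by case: n => // n _; rewrite /UC rmorph0. Qed.

(* Main.v *)
Require Import Defs.
From HB Require Import structures.
From mathcomp Require Import all_boot all_algebra.
From mathcomp Require Import ring zify.

Set Implicit Arguments.
Unset Strict Implicit.
Unset Printing Implicit Defensive.

Import GRing.Theory.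
Local Open Scope ring_scope.

(** Say that (x, y, c) is an Askey-Wilson triple if the three elements
    x + (q y c - q^-1 c y) / (q^2 - q^-2) and its cyclic shifts are central.
    The braid formula y + (q x^2 y - ...) / ... only sees the q-commutator of
    x and y, which by the third relation of the triple is a central element
    minus a multiple of c. So on a triple it collapses to
    y' = y + (c x - x c) / (q - q^-1); combining this with the relation that
    expresses y through c and x gives two things:
    - (y', x, c) is again an Askey-Wilson triple, with the same c and with the
      first two central elements exchanged (braid_AWtriple);
    - q y' + q^-1 y = kappa - x c with kappa central (braid_recurrence).

    Let f be the homomorphism from the q-Onsager algebra to Delta_q. It sends
    (A, B) to the first two entries of the triple (A, B, C), and precomposing f
    with T0 T1 amounts to two braid steps on that pair. Hence the images
    x_n of B_{n delta + alpha_0} are the successive entries produced by braid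
    steps from (x_0, x_{-1}) = (A, B) (braid_orbit), and they satisfy the
    recurrence q x_{n+1} + q^-1 x_{n-1} = kappa_n - x_n C, where kappa_n
    alternates between beta and alpha. Up to powers of - q^-1 this is the
    Chebyshev recurrence in C with an inhomogeneous term, and solving it gives
    the closed form (chebyshev_recurrence, braid_iter_closed_form). No
    endomorphism of Delta_q has to be constructed: only homomorphisms out of the
    q-Onsager algebra occur, and those are determined by the images of A and B.

    For B_{n delta + alpha_1}, the q-Onsager relations show that the inverse of
    a braid automorphism is given by the braid formula for q^-1 (braidVK).
    Since (B, A, C) is a triple for q^-1 whenever (A, B, C) is one for q, the
    second identity is the first one with q replaced by q^-1, A exchanged with
    B, and alpha with beta. *)

(** * Linear identities by comparison of coefficients *)

Section LinearCombinations.
Variables (F : fieldType) (V : lmodType F).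

(** Syntax of linear combinations, so that an identity in a module reduces to
    one identity of scalars for each of the vectors that occur. *)
Inductive lterm :=
| LVar of nat | LZero | LAdd of lterm & lterm | LOpp of lterm
| LScale of F & lterm.

Fixpoint leval (e : seq V) t : V :=
  match t with
  | LVar i => e`_i
  | LZero => 0
  | LAdd s t => leval e s + leval e t
  | LOpp t => - leval e t
  | LScale c t => c *: leval e t
  end.

Fixpoint lcoef t (i : nat) : F :=
  match t with
  | LVar j => if i == j then 1 else 0
  | LZero => 0
  | LAdd s t => lcoef s i + lcoef t i
  | LOpp t => - lcoef t i
  | LScale c t => c * lcoef t i
  end.

Fixpoint same_coefs s t n : Prop :=
  if n is m.+1 then lcoef s m = lcoef t m /\ same_coefs s t m else True.

Lemma leval_sum e t : leval e t = \sum_(i < size e) lcoef t i *: e`_i.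
Proof.
elim: t => /= [j||s -> t ->|t ->|c t ->].
- have [lt_j|ge_j] := ltnP j (size e); last first.
    rewrite nth_default // big1 // => i _; case: eqP => [eq_ij|_].
      by rewrite -eq_ij leqNgt ltn_ord in ge_j.
    by rewrite scale0r.
  rewrite (bigD1 (Ordinal lt_j)) //= eqxx scale1r big1 ?addr0 // => i.
  by rewrite -val_eqE /= => /negPf->; rewrite scale0r.
- by rewrite big1 // => i _; rewrite scale0r.
- by rewrite -big_split; apply: eq_bigr => i _; rewrite scalerDl.
- by rewrite -sumrN; apply: eq_bigr => i _; rewrite scaleNr.
- by rewrite scaler_sumr; apply: eq_bigr => i _; rewrite scalerA.
Qed.

Lemma leval_eq e s t : same_coefs s t (size e) -> leval e s = leval e t.
Proof.
move=> st; rewrite !leval_sum; apply: eq_bigr => i _; congr (_ *: _).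
elim: (size e) st i => [|n IHn] /= => [_ []//|[eq_n st] i].
have := ltn_ord i; rewrite ltnS leq_eqVlt => /orP[/eqP-> //|lt_i].
exact: (IHn st (Ordinal lt_i)).
Qed.

End LinearCombinations.

(** Vectors are compared up to conversion: the same product can carry different,
    convertible, instance paths. *)
Ltac lin_index x e :=
  match e with
  | ?y :: _ => let _ := constr:(erefl : x = y) in constr:(0%N)
  | _ :: ?e' => let i := lin_index x e' in constr:(S i)
  end.

Ltac lin_vars t e :=
  lazymatch t with
  | GRing.add ?a ?b => let e' := lin_vars a e in lin_vars b e'
  | GRing.opp ?a => lin_vars a e
  | GRing.scale _ ?a => lin_vars a e
  | GRing.zero => e
  | ?x => match e with
          | _ => let _ := lin_index x e in e
          | _ => constr:(x :: e)
          end
  end.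

Ltac lin_reify F t e :=
  lazymatch t with
  | GRing.add ?a ?b => let a' := lin_reify F a e in
                       let b' := lin_reify F b e in constr:(@LAdd F a' b')
  | GRing.opp ?a => let a' := lin_reify F a e in constr:(@LOpp F a')
  | GRing.scale ?c ?a => let a' := lin_reify F a e in constr:(@LScale F c a')
  | GRing.zero => constr:(@LZero F)
  | ?x => let i := lin_index x e in constr:(@LVar F i)
  end.

Ltac lin_comb F :=
  lazymatch goal with
  | |- @eq ?V ?s ?t =>
    let e := lin_vars s (@nil V) in
    let e := lin_vars t e in
    let s' := lin_reify F s e in
    let t' := lin_reify F t e in
    apply: (@leval_eq F _ e s' t'); rewrite /=; repeat split
  end.

(** Expands both sides into linear combinations of monomials of the
    noncommutative algebra R, and leaves the identities between the scalars. *)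
Ltac alg_comb F R :=
  repeat (rewrite ?(@mulrDl R, @mulrDr R, @mulNr R, @mulrN R,
                    @mulr0 R, @mul0r R, @mulr1 R, @mul1r R)
                  -?(@scalerAl F R, @scalerAr F R));
  rewrite ?(@mulrA R); lin_comb F.

(** * Braid steps on Askey-Wilson triples *)

Section QCommutator.
Variables (F : fieldType) (p : F) (R : algType F).
Implicit Types x y z c k l g : R.

Definition qcomm x y : R := p *: (x * y) - p^-1 *: (y * x).

Lemma qcommBZl a x y z : qcomm (x - a *: y) z = qcomm x z - a *: qcomm y z.
Proof. by rewrite /qcomm; alg_comb F R; ring. Qed.

Lemma qcommBZr a x y z : qcomm z (x - a *: y) = qcomm z x - a *: qcomm z y.
Proof. by rewrite /qcomm; alg_comb F R; ring. Qed.

Lemma qcomm_comm k x : GRing.comm k x -> qcomm k x = qcomm x k.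
Proof. by rewrite /qcomm => ->. Qed.

(** Both sides apply to y the q-commutation with x on the left and on the right;
    these operators are combinations of left and right multiplication by x,
    hence commute. *)
Lemma qcommA x y : qcomm x (qcomm y x) = qcomm (qcomm x y) x.
Proof. by rewrite /qcomm; alg_comb F R; ring. Qed.

(** The bracket in the braid formula is an ordinary commutator of x with the
    q-commutator of x and y. *)
Lemma braidE x y : braid p x y =
  y + ((p - p^-1) * (p ^+ 2 - p ^- 2))^-1 *: (x * qcomm x y - qcomm x y * x).
Proof. by rewrite /braid /qcomm expr2; alg_comb F R; ring. Qed.

Lemma AWeltE x y z :
  AWelt p x y z = x + (p ^+ 2 - p ^- 2)^-1 *: qcomm y z.
Proof. by []. Qed.

(** The name of each central value follows the relation for x (l), y (k), c (g);
    k comes first because it governs the next braid step. *)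
Definition AWtriple k l g x y c :=
  [/\ AWelt p x y c = l, AWelt p y c x = k & AWelt p c x y = g].

Hypotheses (p_neq0 : p != 0) (p4_neq1 : p ^+ 4 != 1).

(* The nonvanishing conditions in the form in which clearing denominators
   produces them. *)
Let nz : [&& p != 0, (p * p) ^+ 2 - 1 != 0 & p * p - 1 != 0].
Proof.
rewrite p_neq0 -expr2 -exprM !subr_eq0 p4_neq1 /=.
by apply: contra_neq p4_neq1 => p2; rewrite (exprM p 2 2) p2 expr1n.
Qed.

(** The alternative solution y' of the triple relation for y, obtained by
    exchanging the two factors in the q-commutator. The relation for c makes
    the q-commutator of x and y equal to (p^2 - p^-2)(g - c), and g commutes
    with x. *)
Lemma braid_AW k l g x y c : (forall z, GRing.comm g z) ->
  AWtriple k l g x y c ->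
  braid p x y = k - (p ^+ 2 - p ^- 2)^-1 *: qcomm x c.
Proof.
move=> g_central [_ yE cE].
have xyE : qcomm x y = (p ^+ 2 - p ^- 2) *: (g - c).
  rewrite -cE AWeltE addrAC subrr add0r.
  by alg_comb F R; field; case/and3P: nz => -> ->.
have gx : g * x = x * g := g_central x.
have xyC : x * qcomm x y - qcomm x y * x = (p ^+ 2 - p ^- 2) *: (c * x - x * c).
  by rewrite xyE -scalerAr -scalerAl mulrBr mulrBl gx; alg_comb F R; ring.
by rewrite braidE xyC -yE AWeltE /qcomm; alg_comb F R; field.
Qed.

(** The three relations for (y', x, c) say the same as those for (x, y, c),
    because q-commuting with c, or with x, can be moved from one side to the
    other (qcommA). *)
Lemma braid_AWtriple k l g x y c :
    (forall z, [/\ GRing.comm k z, GRing.comm l z & GRing.comm g z]) ->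
  AWtriple k l g x y c -> AWtriple l k g (braid p x y) x c.
Proof.
move=> central xyc; rewrite (braid_AW _ xyc) => [|z]; last by case: (central z).
have [xE yE cE] := xyc.
have yE' : y = k - (p ^+ 2 - p ^- 2)^-1 *: qcomm c x by rewrite -yE addrK.
have kC z : qcomm k z = qcomm z k by apply: qcomm_comm; case: (central z).
split.
- by rewrite AWeltE subrK.
- rewrite -xE !AWeltE yE'; congr (_ + _ *: _).
  by rewrite qcommBZl qcommBZr kC qcommA.
- rewrite -cE !AWeltE yE'; congr (_ + _ *: _).
  by rewrite qcommBZl qcommBZr kC qcommA.
Qed.

(** In p y' + p^-1 y, with y and y' both expressed through x and c, the terms
    in c x cancel and only x c survives. *)
Lemma braid_recurrence k l g x y c : (forall z, GRing.comm g z) ->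
  AWtriple k l g x y c ->
  braid p x y = p^-1 *: ((p + p^-1) *: k - x * c - p^-1 *: y).
Proof.
move=> g_central xyc; rewrite (braid_AW g_central xyc).
have [_ <- _] := xyc; rewrite !AWeltE /qcomm.
by alg_comb F R; field; case/and3P: nz => -> ->.
Qed.

Lemma qnum3 : qnum p 3 = p ^+ 2 + 1 + p ^- 2.
Proof.
rewrite /qnum; change ((p ^+ 3 - p ^- 3) / (p - p^-1) = p ^+ 2 + 1 + p ^- 2).
by field; case/and3P: nz => -> _ ->.
Qed.

(** The two braid formulas are polynomials in the commuting operators L, R of
    left and right multiplication by x. Their product differs from 1 by a
    multiple of (L - R) P, where P y = 0 is the q-Onsager relation. *)
Lemma braidVK x y : qDG_lhs p x y = qDG_rhs p x y ->
  braid p^-1 x (braid p x y) = y.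
Proof.
move=> xy; pose G := qDG_lhs p x y - qDG_rhs p x y.
pose e := (p - p^-1) * (p ^+ 2 - p ^- 2).
suff -> : braid p^-1 x (braid p x y) = y + e^-1 ^+ 2 *: (x * G - G * x).
  by rewrite /G xy subrr mulr0 mul0r subrr scaler0 addr0.
have eV : (p^-1 - p) * (p^-1 ^+ 2 - p^-1 ^- 2) = e.
  by rewrite /e !exprVn invrK; ring.
rewrite /G /qDG_lhs /qDG_rhs qnum3 /braid invrK eV /e.
rewrite !(@exprS R) (@expr0 R) (@mulr1 R).
by alg_comb F R; field.
Qed.

(** A pair holds two consecutive terms, the newer one first. *)
Definition braid_step (u : R * R) : R * R := (braid p u.1 u.2, u.1).

Lemma iter_braid_step_AWtriple k l g x y c n :
    (forall z, [/\ GRing.comm k z, GRing.comm l z & GRing.comm g z]) ->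
    AWtriple k l g x y c -> let u := iter n braid_step (x, y) in
  AWtriple (if odd n then l else k) (if odd n then k else l) g u.1 u.2 c.
Proof.
move=> central xyc /=; elim: n => //= n; case: (odd n) => /= IHn.
  by apply: braid_AWtriple IHn => z; case: (central z).
exact: braid_AWtriple IHn.
Qed.

End QCommutator.

(** * Solution of the inhomogeneous Chebyshev recurrence *)

Section Chebyshev.
Variables (F : fieldType) (R : algType F) (s : F) (c : R).

(** The index is shifted by one, so that U_{-1} = 0 is the initial value at 0. *)
Definition chebV (n : nat) : R := horner_alg c (chebU F (n%:Z - 1)).

Lemma chebV0 : chebV 0 = 0.
Proof. by rewrite /chebV rmorph0. Qed.

Lemma chebV1 : chebV 1 = 1.
Proof. by rewrite /chebV rmorph1. Qed.

Lemma chebVSS n : chebV n.+2 = chebV n.+1 * c - chebV n.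
Proof.
have V m : chebV m.+1 = horner_alg c (chebU_nat F m).
  by rewrite /chebV (_ : m.+1%:Z - 1 = m) //; lia.
case: n => [|n]; first by rewrite chebV0 chebV1 mul1r subr0 V horner_algX.
rewrite !V [chebU_nat F n.+2]/= mulrC rmorphB rmorphM; congr (_ * _ - _).
exact: horner_algX.
Qed.

(** The sum of s^m V_m over all m <= n of the same parity as n: the response of
    the recurrence to a source acting at every second step. *)
Fixpoint chebW (n : nat) : R :=
  if n is m.+2 then s ^+ n *: chebV n + chebW m else s ^+ n *: chebV n.

Lemma chebWE n : chebW n.+2 = s ^+ n.+2 *: chebV n.+2 + chebW n.
Proof. by []. Qed.

(** Every summand of chebW n.+2 obeys the homogeneous recurrence except s V_1,
    for which the terms of lower index are absent; that summand occurs exactly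
    when n is odd, and it contributes s. *)
Lemma chebWSS n :
  chebW n.+2 = s *: (chebW n.+1 * c - s *: chebW n + (odd n)%:R).
Proof.
elim/ltn_ind: n => -[|[|n]] IHn.
- rewrite /= !chebVSS chebV0 chebV1.
  rewrite !(mul1r, subr0, addr0, scaler0).
  by rewrite expr1 -scalerAl scalerA mul1r -expr2.
- rewrite /= !chebVSS chebV0 chebV1 !(mul1r, subr0, addr0, scaler0).
  alg_comb F R; ring.
- have -> : odd n.+2 = odd n by rewrite !oddS negbK.
  rewrite chebWE [in LHS]IHn // (chebVSS n.+2) (chebWE n.+1) (chebWE n) !(exprS s).
  by alg_comb F R; ring.
Qed.

(** Reindexed by the distance 2 j to the top index, chebW is the sum over all
    natural j; any bound N beyond which the Chebyshev index is negative will
    do. *)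
Lemma chebW_sum (p : F) N n : s = - p^-1 -> (n <= N.*2)%N ->
  chebW n = (-1) ^+ n *:
    \sum_(j < N) p ^ (2 * j%:Z - n%:Z) *: horner_alg c (chebU F (n%:Z - 2 * j%:Z - 1)).
Proof.
move=> sE; elim: N n => [|N IHN] n.
  by case: n => // _; rewrite big_ord0 scaler0 /= chebV0 scaler0.
have first m : s ^+ m *: chebV m
  = (-1) ^+ m *: (p ^ (2 * 0%:Z - m%:Z) *: horner_alg c (chebU F (m%:Z - 2 * 0%:Z - 1))).
  rewrite scalerA sE (exprNn p^-1) exprVn exprnN mulr0 sub0r.
  by congr (_ *: horner_alg c (chebU F _)); rewrite subr0.
have small m : (m < 2)%N -> chebW m = s ^+ m *: chebV m by case: m => [|[|m]].
rewrite doubleS big_ord_recl scalerDr -first => le_n.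
have [lt_n2|] := ltnP n 2.
  rewrite small // big1 ?scaler0 ?addr0 // => j _.
  rewrite (_ : chebU F _ = 0) ?rmorph0 ?scaler0 // lift0.
  by case E : (_ - 1) => [m|m] //; lia.
case: n le_n => [|[|n]] // le_n _; rewrite chebWE IHN //.
congr (_ + _ *: _); first by rewrite !exprS !mulN1r opprK.
by apply: eq_bigr => j _; rewrite lift0; congr (p ^ _ *: horner_alg c (chebU F _)); lia.
Qed.

(** The solution is the superposition of the responses to x_0 = a, to
    x_{-1} = b, and to the sources k and l, which act at alternate steps. *)
Lemma chebyshev_recurrence (a b k l : R) (x : nat -> R) :
    x 0%N = a -> x 1%N = s *: (a * c - s *: b - k) ->
    (forall n, x n.+2 =
       s *: (x n.+1 * c - s *: x n - (if odd n then k else l))) ->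
  forall n, x n = s ^+ n *: (a * chebV n.+1) - s ^+ n.+1 *: (b * chebV n)
    - l * chebW n.-1 - k * chebW n.
Proof.
move=> x0 x1 xSS; have W0 : chebW 0 = 0 by rewrite /= chebV0 scaler0.
have W1 : chebW 1 = s *: 1 by rewrite /= chebV1.
elim/ltn_ind=> -[|[|n]] IHn.
- by rewrite x0 W0 chebV1 chebV0; alg_comb F R; ring.
- by rewrite x1 W0 W1 chebVSS chebV1 chebV0; alg_comb F R; ring.
rewrite xSS !IHn // [n.+2.-1]/= [n.+1.-1]/= (chebVSS n.+1) (chebVSS n) chebWSS.
case: n {IHn} => [|n].
  by rewrite W0 W1 chebV1 chebV0 mulr0n; alg_comb F R; ring.
rewrite [n.+1.-1]/= (chebWSS n) oddS !(exprS s); case: (odd n).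
  by rewrite mulr1n mulr0n; alg_comb F R; ring.
by rewrite mulr1n mulr0n; alg_comb F R; ring.
Qed.

End Chebyshev.

Arguments braid_step {F} p {R} u.

(** * Braid steps as orbits of homomorphisms *)

Section Orbits.
Variables (F : fieldType) (p : F).

(** Inverting p reverses the q-commutator: a triple for p is one for p^-1
    after the exchange of its first two entries. *)
Lemma AWeltV (R : algType F) (x y z : R) : AWelt p^-1 x y z = AWelt p x z y.
Proof.
rewrite /AWelt invrK !exprVn invrK -(opprB (p ^+ 2)) invrN.
by alg_comb F R; ring.
Qed.

Lemma braid_morph (R R' : algType F) (f : {lrmorphism R -> R'}) x y :
  f (braid p x y) = braid p (f x) (f y).
Proof.
have fZ (c : F) u : f (c *: u) = c *: f u by exact: linearZZ.
have fM u v : f (u * v) = f u * f v by exact: rmorphM.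
have fB u v : f (u - v) = f u - f v by exact: rmorphB.
have fD u v : f (u + v) = f u + f v by exact: rmorphD.
by rewrite /braid !expr2 !(fB, fD, fZ, fM).
Qed.

Lemma lrmorphism_inverse (R : algType F) (f : {lrmorphism R -> R}) g :
  cancel f g -> cancel g f -> exists h : {lrmorphism R -> R}, h =1 g.
Proof.
move=> fK gK; pose gZ := GRing.isZmodMorphism.Build _ _ _ (can2_zmod_morphism fK gK).
pose gM := GRing.isMonoidMorphism.Build _ _ _ (can2_monoid_morphism fK gK).
pose gS := GRing.isScalable.Build _ _ _ _ _ (can2_scalable fK gK).
pose h : {lrmorphism R -> R} := HB.pack g gZ gM gS.
by exists h.
Qed.

(** The automorphism S0 S1 sends (x, y) to the pair reached by two braid
    steps, and braid steps commute with homomorphisms; induction on the number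
    of factors absorbs one factor S0 S1 into the homomorphism. *)
Lemma braid_orbit (O R : algType F) (S0 S1 : {lrmorphism O -> O})
    (f : {lrmorphism O -> R}) x y n :
    S0 x = x -> S0 y = braid p x y -> S1 y = y -> S1 x = braid p y x ->
  f (iter n./2 (S0 \o S1) (if odd n then S0 y else x))
    = (iter n (braid_step p) (f x, f y)).1.
Proof.
move=> S0x S0y S1y S1x; pose T : {lrmorphism O -> O} := S0 \o S1.
have orbit r (h : {lrmorphism O -> R}) :
    (h (iter r T x), h (iter r T y)) = iter r.*2 (braid_step p) (h x, h y).
  elim: r h => //= r IHr h; have := IHr (h \o T); rewrite /= => ->.
  rewrite -!iterS !iterSr /braid_step /= S1y S1x S0y !braid_morph S0x S0y.
  by rewrite braid_morph.
(* For odd n, S0 y = (S0 S1) y is the older entry after one more double step. *)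
rewrite -{3}[n]odd_double_half.
have [fx fy] := (congr1 fst (orbit n./2 f), congr1 snd (orbit n./2.+1 f)).
case: (odd n); last exact: fx.
by rewrite -{1}S1y; rewrite (iterSr _ T y) in fy; exact: fy.
Qed.

(** Every braid step keeps the triple, so the iterates satisfy the Chebyshev
    recurrence with s = - p^-1, whose sources are the central values of the
    triple scaled by p + p^-1. *)
Lemma braid_iter_closed_form (R : algType F) (k l g x y c : R) n
    (U := fun m : int => horner_alg c (chebU F m)) :
    p != 0 -> p ^+ 4 != 1 ->
    (forall z, [/\ GRing.comm k z, GRing.comm l z & GRing.comm g z]) ->
    AWtriple p k l g x y c ->
  (iter n (braid_step p) (x, y)).1 =
      ((-1) ^+ n * p ^ (- n%:Z)) *: (x * U n%:Z)
    + ((-1) ^+ n * p ^ (- n%:Z - 1)) *: (y * U (n%:Z - 1))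
    + (-1) ^+ n *: ((p + p^-1) *: l *
        \sum_(j < n.+1) p ^ (2 * j%:Z - n%:Z + 1) *: U (n%:Z - 2 * j%:Z - 2))
    + (-1) ^ (n%:Z - 1) *: ((p + p^-1) *: k *
        \sum_(j < n.+1) p ^ (2 * j%:Z - n%:Z) *: U (n%:Z - 2 * j%:Z - 1)).
Proof.
move=> p_neq0 p4_neq1 central xyc; pose s := - p^-1.
pose u m := iter m (braid_step p) (x, y).
have u_rec m : (u m.+1).1 =
    s *: ((u m).1 * c - s *: (u m).2
          - (p + p^-1) *: (if odd m then l else k)).
  have [g_central triple] :
      (forall z, GRing.comm g z) /\ _ :=
    conj (fun z => let: And3 _ _ gz := central z in gz)
         (iter_braid_step_AWtriple p_neq0 p4_neq1 m central xyc).
  rewrite [LHS](braid_recurrence p_neq0 p4_neq1 g_central triple) -/(u m) /s.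
  by alg_comb F R; ring.
rewrite -/(u n) (@chebyshev_recurrence F R s c x y ((p + p^-1) *: k)
  ((p + p^-1) *: l) (fun m => (u m).1)) //; last first.
- by move=> m; have := u_rec m.+1; rewrite /=; case: (odd m).
have sX m : s ^+ m = (-1) ^+ m * p ^ (- m%:Z).
  by rewrite /s (exprNn p^-1) exprVn exprnN.
have VU m : chebV c m.+1 = U m by rewrite /chebV (_ : m.+1%:Z - 1 = m) //; lia.
have W_sum m N : (m <= N.*2)%N -> chebW s c m = (-1) ^+ m *:
    \sum_(j < N) p ^ (2 * j%:Z - m%:Z) *: U (m%:Z - 2 * j%:Z - 1).
  exact: chebW_sum.
have -> : (-1) ^ (n%:Z - 1) = - (-1) ^+ n :> F.
  by rewrite expfzDr ?oppr_eq0 ?oner_eq0 // exprN1 invrN1 mulrN1.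
rewrite VU; congr (_ + _ + _ + _).
- by rewrite sX.
- rewrite -scaleNr sX exprS mulN1r mulNr opprK; congr (_ * p ^ _ *: _); lia.
- rewrite -mulrN scalerAr; congr (_ * _); case: n => [|n].
    by rewrite big_ord1 /= /chebV /U !rmorph0 !scaler0 oppr0.
  rewrite (W_sum n n.+2); last by lia.
  rewrite exprS mulN1r scaleNr; congr (- (_ *: _)).
  by apply: eq_bigr => j _; congr (p ^ _ *: U _); lia.
- by rewrite scaleNr scalerAr -W_sum //; lia.
Qed.

End Orbits.

(** By AWeltV, (y, x, c) is a triple for p^-1, so this is the previous closed
    form with p inverted, x and y exchanged, and k and l exchanged. *)
Lemma braidV_iter_closed_form (F : fieldType) (p : F) (R : algType F)
    (k l g x y c : R) n
    (U := fun m : int => horner_alg c (chebU F m)) :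
    p != 0 -> p ^+ 4 != 1 ->
    (forall z, [/\ GRing.comm k z, GRing.comm l z & GRing.comm g z]) ->
    AWtriple p k l g x y c ->
  (iter n (braid_step p^-1) (y, x)).1 =
      ((-1) ^+ n * p ^ n%:Z) *: (y * U n%:Z)
    + ((-1) ^+ n * p ^ (n%:Z + 1)) *: (x * U (n%:Z - 1))
    + (-1) ^+ n *: ((p + p^-1) *: k *
        \sum_(j < n.+1) p ^ (n%:Z - 2 * j%:Z - 1) *: U (n%:Z - 2 * j%:Z - 2))
    + (-1) ^ (n%:Z - 1) *: ((p + p^-1) *: l *
        \sum_(j < n.+1) p ^ (n%:Z - 2 * j%:Z) *: U (n%:Z - 2 * j%:Z - 1)).
Proof.
move=> p_neq0 p4_neq1 central [xE yE cE].
have central' z : [/\ GRing.comm l z, GRing.comm k z & GRing.comm g z].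
  by have [] := central z.
have qV_neq0 : p^-1 != 0 by rewrite invr_eq0.
have qV4 : p^-1 ^+ 4 != 1 by rewrite exprVn invr_eq1.
have tripleV : AWtriple p^-1 l k g y x c by split; rewrite AWeltV.
rewrite (braid_iter_closed_form n qV_neq0 qV4 central' tripleV).
rewrite invrK [p^-1 + p]addrC !exprz_inv opprK.
rewrite (_ : - (- n%:Z - 1) = n%:Z + 1); last by lia.
by congr (_ + _ + _ *: (_ * _) + _ *: (_ * _)); apply: eq_bigr => j _;
  rewrite exprz_inv; congr (p ^ _ *: U _); lia.
Qed.

Theorem theorem5p5 (F : closedFieldType) (q : F)
  (charF0 : [pchar F] =i pred0)
  (q_neq0 : q != 0)
  (q_not_root1 : forall m : nat, (0 < m)%N -> q ^+ m != 1)
  (T0 T1 : {lrmorphism Oq q -> Oq q})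
  (T0i T1i : Oq q -> Oq q)
  (T0K : cancel T0 T0i) (T0iK : cancel T0i T0)
  (T1K : cancel T1 T1i) (T1iK : cancel T1i T1)
  (T0A : T0 (OA q) = OA q)
  (T0B : T0 (OB q) = braid q (OA q) (OB q))
  (T1B : T1 (OB q) = OB q)
  (T1A : T1 (OA q) = braid q (OB q) (OA q))
  (natural : {lrmorphism Oq q -> Delta q})
  (naturalA : natural (OA q) = DA q)
  (naturalB : natural (OB q) = DB q)
  (n : nat) :
  natural (Balpha0 T0 T1 n) =
      ((-1) ^+ n * q ^ (- n%:Z)) *: (DA q * UC q n%:Z)
    + ((-1) ^+ n * q ^ (- n%:Z - 1)) *: (DB q * UC q (n%:Z - 1))
    + (-1) ^+ n *: (Dalpha q *
        \sum_(j < n.+1) q ^ (2 * j%:Z - n%:Z + 1) *: UC q (n%:Z - 2 * j%:Z - 2))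
    + (-1) ^ (n%:Z - 1) *: (Dbeta q *
        \sum_(j < n.+1) q ^ (2 * j%:Z - n%:Z) *: UC q (n%:Z - 2 * j%:Z - 1))
  /\
  natural (Balpha1 T0i T1i n) =
      ((-1) ^+ n * q ^ n%:Z) *: (DB q * UC q n%:Z)
    + ((-1) ^+ n * q ^ (n%:Z + 1)) *: (DA q * UC q (n%:Z - 1))
    + (-1) ^+ n *: (Dbeta q *
        \sum_(j < n.+1) q ^ (n%:Z - 2 * j%:Z - 1) *: UC q (n%:Z - 2 * j%:Z - 2))
    + (-1) ^ (n%:Z - 1) *: (Dalpha q *
        \sum_(j < n.+1) q ^ (n%:Z - 2 * j%:Z) *: UC q (n%:Z - 2 * j%:Z - 1)).
Proof.
have q4 : q ^+ 4 != 1 by exact: q_not_root1.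
pose a' := AWelt q (DA q) (DB q) (DC q).
pose b' := AWelt q (DB q) (DC q) (DA q).
pose c' := AWelt q (DC q) (DA q) (DB q).
have central z : [/\ GRing.comm a' z, GRing.comm b' z & GRing.comm c' z].
  exact: Delta_central.
have central' z : [/\ GRing.comm b' z, GRing.comm a' z & GRing.comm c' z].
  by have [az bz cz] := central z; split; assumption.
have triple : AWtriple q b' a' c' (DA q) (DB q) (DC q) by split; reflexivity.
split.
  rewrite /Balpha0 (braid_orbit natural n T0A T0B T1B T1A) naturalA naturalB.
  rewrite (braid_iter_closed_form n q_neq0 q4 central' triple).
  rewrite /Dalpha /Dbeta /UC -/a' -/b'; reflexivity.
have [S0 S0E] := lrmorphism_inverse T0K T0iK.
have [S1 S1E] := lrmorphism_inverse T1K T1iK.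
have S0A : S0 (OA q) = OA q by rewrite S0E -{1}T0A T0K.
have S1B : S1 (OB q) = OB q by rewrite S1E -{1}T1B T1K.
have S0B : S0 (OB q) = braid q^-1 (OA q) (OB q).
  rewrite S0E; apply: (canLR T0K); rewrite braid_morph T0A T0B braidVK //.
  exact: Oq_AB.
have S1A : S1 (OA q) = braid q^-1 (OB q) (OA q).
  rewrite S1E; apply: (canLR T1K); rewrite braid_morph T1A T1B braidVK //.
  exact: Oq_BA.
have -> : Balpha1 T0i T1i n =
    iter n./2 (S1 \o S0) (if odd n then S1 (OA q) else OB q).
  by rewrite /Balpha1 -S1E; apply: eq_iter => z /=; rewrite S0E S1E.
rewrite (braid_orbit natural n S1B S1A S0A S0B) naturalA naturalB.
rewrite (braidV_iter_closed_form n q_neq0 q4 central' triple).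
rewrite /Dalpha /Dbeta /UC -/a' -/b'; reflexivity.
Qed.
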